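(* Let $\rho>0$ be constant in space and time. Assume that for every cell $C_i$ and every time $t$ the discrete divergence-free condition $$\sum_{C_j\in\mathcal{K}_i}|\Gamma_{ij}|\,u_{ij}=0,\qquad u_{ij}=\frac{1}{|\Gamma_{ij}|}\int_{\Gamma_{ij}}\tfrac12(\mathbf{u}_i+\mathbf{u}_j)\cdot\mathbf{n}_{ij}\,dS,$$ and the semi-discrete geometric conservation law $$\frac{\partial |C_i(t)|}{\partial t}-\sum_{C_j\in\mathcal{K}_i}|\Gamma_{ij}|\,V_{ij}=0,\qquad V_{ij}=\frac{1}{|\Gamma_{ij}|}\int_{\Gamma_{ij}}\mathbf{v}\cdot\mathbf{n}_{ij}\,dS,$$ hold. Let $s_{\max}\ge 0$ and consider the semi-discrete ALE finite volume scheme with the Ducros flux and Rusanov-type numerical dissipation, $$\frac{\partial\left(|C_i(t)|\,\rho\,\mathbf{u}_i\right)}{\partial t}+\sum_{C_j\in\mathcal{K}_i}|\Gamma_{ij}|\,(u_{ij}-V_{ij})\,\tfrac12\rho\,(\mathbf{u}_i+\mathbf{u}_j)=\sum_{C_j\in\mathcal{K}_i}|\Gamma_{ij}|\,\tfrac12 s_{\max}\,\rho\,(\mathbf{u}_j-\mathbf{u}_i)\qquad\text{for every cell } C_i.$$ Then the scheme is energy dissipative: for every cell $C_i$, $$\frac{\partial}{\partial t}\left(|C_i(t)|\,\tfrac12\rho\,\mathbf{u}_i^2\right)+\sum_{C_j\in\mathcal{K}_i}|\Gamma_{ij}|\,(u_{ij}-V_{ij})\,\tfrac12\rho\,\mathbf{u}_i\cdot\mathbf{u}_j-\sum_{C_j\in\mathcal{K}_i}|\Gamma_{ij}|\,\tfrac12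 s_{\max}\,\tfrac12\rho\,(\mathbf{u}_j^2-\mathbf{u}_i^2)=-\sum_{C_j\in\mathcal{K}_i}|\Gamma_{ij}|\,\tfrac12 s_{\max}\,\tfrac12\rho\,(\mathbf{u}_j-\mathbf{u}_i)^2\le 0,$$ and, if there are no fluxes through the boundary of the domain, $$\sum_i\frac{\partial\left(|C_i(t)|\,\tfrac12\rho\,\mathbf{u}_i^2\right)}{\partial t}=-\sum_i\sum_{C_j\in\mathcal{K}_i}|\Gamma_{ij}|\,\tfrac12 s_{\max}\,\tfrac12\rho\,(\mathbf{u}_j-\mathbf{u}_i)^2\le 0,$$ so that the total discrete kinetic energy is non-increasing in time.
   Context: Inviscid incompressible flow without gravity or buoyancy is considered, in space dimension $d\in\{2,3\}$. The moving computational domain is partitioned at each time $t$ into finitely many moving cells $C_i(t)\subset\mathbb{R}^d$ of volume $|C_i(t)|=\int_{C_i(t)}d\mathbf{x}$ and fixed connectivity (the topology of the mesh does not change in time). $\mathcal{K}_i$ is the set of cells adjacent to $C_i$, i.e. sharing a face with it (adjacency is symmetric). For $C_j\in\mathcal{K}_i$, $\Gamma_{ij}=\Gamma_{ji}$ is the (time-dependent) common face of $C_i$ and $C_j$, of measure $|\Gamma_{ij}|=\int_{\Gamma_{ij}}dS>0$, and $\mathbf{n}_{ij}=-\mathbf{n}_{ji}$ is the unit normal vector on it pointing from $C_i$ to $C_j$. $\mathbf{v}$ is the local mesh velocity, which is single-valued on faces, and $V_{ij}$ is the edge-averaged normal mesh velocity; hence $u_{ij}=-u_{ji}$ and $V_{ij}=-V_{ji}$.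 Each cell carries one velocity vector $\mathbf{u}_i=\mathbf{u}_i(t)\in\mathbb{R}^d$; the square of a vector denotes its scalar product with itself. The scheme is semi-discrete: space is discretized and time is continuous, with $\mathbf{u}_i(t)$ and $|C_i(t)|$ differentiable in $t$ (so $\partial/\partial t$ is the ordinary time derivative). $s_{\max}$ is an estimate for the maximum local signal velocity; it may depend on the face $\Gamma_{ij}$ and on time, but takes the same value when a face is seen from either of its two adjacent cells. ''No fluxes through the boundary'' means that the only contributions to the sums over $C_j\in\mathcal{K}_i$ come from faces shared by two cells of the mesh, i.e. there are no boundary-face contributions. The total discrete kinetic energy is $\sum_i|C_i(t)|\,\tfrac12\rho\,\mathbf{u}_i^2$. *)

(* Defs.v *)
From HB Require Import structures.
From mathcomp Require Import all_boot all_order all_algebra.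
From mathcomp Require Import all_classical all_reals all_analysis.
Set Implicit Arguments.
Unset Strict Implicit.
Unset Printing Implicit Defensive.
Import Order.TTheory GRing.Theory Num.Theory.
Import numFieldNormedType.Exports.
Local Open Scope classical_set_scope.
Local Open Scope ring_scope.

(* The library's norm on 'rV[R]_d is the sup norm (same topology); the Euclidean
   structure is needed for unit normals, surface area and kinetic energy. *)
Definition dot (R : realType) (d : nat) (x y : 'rV[R]_d) : R :=
  \sum_(k < d) x 0 k * y 0 k.

Definition enorm (R : realType) (d : nat) (x : 'rV[R]_d) : R :=
  Num.sqrt (dot x x).

(* Lebesgue outer measure: infimum of the total volume of countable covers by
   closed boxes. On (measurable) cells it is the d-dimensional volume. *)
Definition lebesgue_vol (R : realType) (d : nat) (A : set 'rV[R]_d) : \bar R :=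
  ereal_inf [set s | exists a b : ('rV[R]_d)^nat,
    [/\ forall n k, a n 0 k <= b n 0 k,
        A `<=` \bigcup_n [set x | forall k, a n 0 k <= x 0 k <= b n 0 k]
      & s = (\sum_(n <oo) (\prod_(k < d) (b n 0 k - a n 0 k))%:E)%E]].

(* A copy of T in which every set is measurable, so that [mu_ext] ranges over
   countable covers by arbitrary sets. *)
Definition discrete_space (T : Type) : Type := T.
HB.instance Definition _ (T : pointedType) := Pointed.on (discrete_space T).
HB.instance Definition _ (T : pointedType) :=
  @isMeasurable.Build default_measure_display (discrete_space T)
    (@discrete_measurable T) (@discrete_measurable0 T)
    (@discrete_measurableC T) (@discrete_measurableU T).

(* pi^(k/2) / Gamma(k/2 + 1), the volume of the unit ball of R^k. *)
Fixpoint unit_ball_volume (R : realType) (k : nat) : R :=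
  match k with
  | 0%N => 1
  | 1%N => 2
  | k'.+2 => 2 * pi / k'.+2%:R * unit_ball_volume R k'
  end.

(* unit_ball_volume k * (diam A / 2) ^ k when diam A <= delta, +oo otherwise;
   the element 0 gives the empty set the value 0. *)
Definition hausdorff_gauge (R : realType) (d k : nat) (delta : R)
    (A : set (discrete_space 'rV[R]_d)) : \bar R :=
  if `[< forall x y : 'rV[R]_d, A x -> A y -> enorm (x - y) <= delta >]
  then ereal_sup [set e | e = 0%E \/ exists x y : 'rV[R]_d,
         [/\ A x, A y
           & e = (unit_ball_volume R k * (enorm (x - y) / 2) ^+ k)%:E]]
  else +oo%E.

(* The k-dimensional Hausdorff outer measure, normalized so that it is the
   usual length (k = 1) and area (k = 2). *)
Definition hausdorff (R : realType) (d k : nat) (A : set 'rV[R]_d) : \bar R :=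
  ereal_sup [set mu_ext (hausdorff_gauge k delta)
                   (A : set (discrete_space 'rV[R]_d))
            | delta in [set delta : R | 0 < delta]].

Lemma hausdorff_gauge_ge0 (R : realType) (d k : nat) (delta : R)
    (A : set (discrete_space 'rV[R]_d)) :
  (0 <= hausdorff_gauge k delta A)%E.
Proof.
rewrite /hausdorff_gauge; case: ifP => _; last exact: leey.
by apply: ereal_sup_ubound; left.
Qed.

Lemma hausdorff_gauge0 (R : realType) (d k : nat) (delta : R) :
  hausdorff_gauge k delta (set0 : set (discrete_space 'rV[R]_d)) = 0%E.
Proof.
apply/eqP; rewrite eq_le hausdorff_gauge_ge0 andbT /hausdorff_gauge.
case: asboolP => [_|H]; last by exfalso; apply: H.
by apply: ge_ereal_sup => e [->//|[x [y [+ _ _]]]].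
Qed.

Section hausdorff_outer_measure.
Context (R : realType) (d k : nat).
Let H := @hausdorff R d k.

Lemma hausdorff0 : H set0 = 0%E.
Proof.
rewrite /H /hausdorff; apply/eqP; rewrite eq_le; apply/andP; split.
  apply: ge_ereal_sup => _ [delta _ <-]; rewrite mu_ext0//.
    exact: hausdorff_gauge0.
  exact: hausdorff_gauge_ge0.
apply: ereal_sup_ubound; exists 1 => //=; rewrite mu_ext0//.
  exact: hausdorff_gauge0.
exact: hausdorff_gauge_ge0.
Qed.

Lemma hausdorff_ge0 A : (0 <= H A)%E.
Proof.
apply: le_trans (ereal_sup_ubound _); last by exists 1; [exact: ltr01|].
by apply: mu_ext_ge0; exact: hausdorff_gauge_ge0.
Qed.

Lemma le_hausdorff : {homo H : A B / A `<=` B >-> (A <= B)%E}.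
Proof.
move=> A B AB; apply: ge_ereal_sup => _ [delta delta0 <-].
apply: le_trans (ereal_sup_ubound _); last by exists delta.
exact: le_mu_ext.
Qed.

Lemma hausdorff_sigma_subadditive : sigma_subadditive H.
Proof.
move=> F; apply: ge_ereal_sup => _ [delta delta0 <-].
apply: (le_trans (mu_ext_sigma_subadditive
  (@hausdorff_gauge_ge0 R d k delta) _)).
apply: lee_nneseries => [i _ _|i _].
  by apply: mu_ext_ge0; exact: hausdorff_gauge_ge0.
by apply: ereal_sup_ubound; exists delta.
Qed.

HB.instance Definition _ := isOuterMeasure.Build R 'rV[R]_d H
  hausdorff0 hausdorff_ge0 le_hausdorff hausdorff_sigma_subadditive.

End hausdorff_outer_measure.

Definition surface_outer (R : realType) (d : nat) :
    {outer_measure set 'rV[R]_d -> \bar R} :=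
  @hausdorff R d d.-1.

(* R^d with the Caratheodory-measurable sets of the (d - 1)-dimensional
   Hausdorff measure, and dS, the restriction of that measure to them. *)
Definition surface_space (R : realType) (d : nat) :=
  caratheodory_type (surface_outer R d).
HB.instance Definition _ (R : realType) (d : nat) :=
  Measurable.on (surface_space R d).

Definition surface (R : realType) (d : nat) :
    {measure set (surface_space R d) -> \bar R} :=
  [the measure _ _ of (surface_outer R d
    : set (caratheodory_type (surface_outer R d)) -> \bar R)].

(* A moving mesh of R^d of fixed connectivity over the times t in J.

   All indices of I denote cells; the mesh, i.e. the partition of the
   computational domain \bigcup_(i in mesh) cell i t, consists of those in
   [mesh]. Indices outside [mesh] are exterior cells, which a mesh cell sees only
   across a boundary face; a mesh without them has mesh = [set: I].

   Cells are closed, so that the common face of two adjacent cells is their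
   intersection; "almost every" point of a face discards its edges and corners. *)
Record moving_mesh (R : realType) (d : nat) (I : finType) (J : set R) :=
  MovingMesh {
  mesh : {set I};
  cell : I -> R -> set 'rV[R]_d;
  adj : rel I;
  normal : I -> I -> R -> 'rV[R]_d -> 'rV[R]_d;
  velocity : R -> 'rV[R]_d -> 'rV[R]_d;
  face := fun (i j : I) (t : R) =>
    (cell i t `&` cell j t : set (surface_space R d));
  cell_compact : forall i t, J t -> compact (cell i t);
  cell_overlap : forall i j t, J t -> i != j ->
    lebesgue_vol (cell i t `&` cell j t) = 0%E;
  (* adjacent = sharing a nondegenerate face; independent of t *)
  adjP : forall i j t, J t -> adj i j <-> i != j /\ (0 < surface R d (face i j t))%E;
  face_finite : forall i j t, J t -> adj i j -> (surface R d (face i j t) < +oo)%E;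
  normal_measurable : forall i j t k, J t -> adj i j ->
    measurable_fun (face i j t) (fun x : surface_space R d => normal i j t x 0 k);
  normal_unit : forall i j t x, J t -> adj i j -> face i j t x ->
    enorm (normal i j t x) = 1;
  normal_sym : forall i j t x, J t -> adj i j -> face i j t x ->
    normal j i t x = - normal i j t x;
  (* orthogonal to the face at x, to first order *)
  normal_orthogonal : forall i j t, J t -> adj i j ->
    {ae surface R d, forall x : surface_space R d, face i j t x ->
      forall e : R, 0 < e -> \forall y \near (x : 'rV[R]_d), face i j t y ->
        `|dot (normal i j t x) (y - x)| <= e * enorm (y - x)};
  normal_direction : forall i j t, J t -> adj i j ->
    {ae surface R d, forall x : surface_space R d, face i j t x ->
      \forall h \near 0^'+, cell i t (x - h *: normal i j t x)
                          /\ cell j t (x + h *: normal i j t x)};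
  (* [velocity t x] is the velocity of a point moving with the face *)
  velocity_face : forall i j t, J t -> adj i j ->
    {ae surface R d, forall x : surface_space R d, face i j t x ->
      exists y : R -> 'rV[R]_d, [/\ y t = x,
        is_derive t 1 y (velocity t x) & \forall s \near t, face i j s (y s)]};
  velocity_integrable : forall i j t, J t -> adj i j ->
    (surface R d).-integrable (face i j t)
      (fun x => (dot (velocity t x) (normal i j t x))%:E)
}.

Section mesh_quantities.
Context (R : realType) (d : nat) (I : finType) (J : set R).
Variable M : moving_mesh d I J.

Definition volume (i : I) (t : R) : R := fine (lebesgue_vol (cell M i t)).

Definition area (i j : I) (t : R) : R := fine (surface R d (face M i j t)).

(* u_ij, for the cell velocities u *)
Definition face_velocity (u : I -> R -> 'rV[R]_d) (i j : I) (t : R) : R :=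
  (area i j t)^-1 *
  \int[surface R d]_(x in face M i j t)
    dot (2^-1 *: (u i t + u j t)) (normal M i j t x).

(* V_ij *)
Definition face_mesh_velocity (i j : I) (t : R) : R :=
  (area i j t)^-1 *
  \int[surface R d]_(x in face M i j t) dot (velocity M t x) (normal M i j t x).

Definition kinetic_energy (rho : R) (u : I -> R -> 'rV[R]_d) (i : I) (t : R) : R :=
  volume i t * (2^-1 * rho * dot (u i t) (u i t)).

End mesh_quantities.

(* Main.v *)
Require Import Defs.
From mathcomp Require Import all_boot all_order all_algebra.
From mathcomp Require Import all_classical all_reals all_analysis.
From mathcomp Require Import ring.
Set Implicit Arguments.
Unset Strict Implicit.
Unset Printing Implicit Defensive.
Import Order.TTheory GRing.Theory Num.Theory.
Import numFieldNormedType.Exports.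
Local Open Scope classical_set_scope.
Local Open Scope ring_scope.

(** Take the scalar product of the momentum equation of a cell with its own
    velocity [u_i].  The product rule turns [u_i . d(m rho u_i)/dt], with
    [m = |C_i|], into the rate of kinetic energy plus
    [1/2 rho dm/dt |u_i|^2] ([is_derive_energy]).  The Ducros flux contributes
    [1/2 rho a_ij (|u_i|^2 + u_i . u_j)], where
    [a_ij = |Gamma_ij| (u_ij - V_ij)] is the volume flux relative to the moving
    face; by incompressibility and the geometric conservation law these fluxes
    add up to [- dm/dt], so the [|u_i|^2] part cancels exactly the volume term.
    The dissipation is split by
    [u_i . (u_j - u_i) = 1/2 (|u_j|^2 - |u_i|^2) - 1/2 |u_j - u_i|^2]:
    a conservative energy diffusion and a term of a fixed sign
    ([ducros_balance]).

    Without boundary faces, the remaining energy flux and energy diffusion are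
    antisymmetric in the two cells of a face and cancel in the sum over the mesh
    ([sum_antisym_eq0]); for the flux this rests on the antisymmetry of the
    normals, which makes [u_ij] and [V_ij] antisymmetric
    ([Rintegral_normal_antisym]).  The total energy is then a differentiable
    function with nonpositive derivative on an interval of times, hence
    nonincreasing. *)

(** * Euclidean scalar product *)

Section dot_algebra.
Context {R : realType} {d : nat}.
Implicit Types (x y z : 'rV[R]_d) (a : R).

Lemma dotC x y : dot x y = dot y x.
Proof. by apply: eq_bigr => k _; rewrite mulrC. Qed.

Lemma dotDr x y z : dot x (y + z) = dot x y + dot x z.
Proof. by rewrite -big_split; apply: eq_bigr => k _; rewrite mxE mulrDr. Qed.

Lemma dotZr a x y : dot x (a *: y) = a * dot x y.
Proof. by rewrite mulr_sumr; apply: eq_bigr => k _; rewrite mxE mulrCA. Qed.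

Lemma dotNr x y : dot x (- y) = - dot x y.
Proof. by rewrite -scaleN1r dotZr mulN1r. Qed.

Lemma dot0r x : dot x 0 = 0.
Proof. by rewrite -(scale0r x) dotZr mul0r. Qed.

Lemma dot_sumr (J : finType) (P : pred J) x (F : J -> 'rV[R]_d) :
  dot x (\sum_(j | P j) F j) = \sum_(j | P j) dot x (F j).
Proof. exact: (big_morph (dot x) (dotDr x) (dot0r x)). Qed.

Lemma dot_ge0 x : 0 <= dot x x.
Proof. by apply: sumr_ge0 => k _; rewrite -expr2 sqr_ge0. Qed.

Lemma dot_sub_sqr x y :
  dot (y - x) (y - x) = dot y y - 2 * dot x y + dot x x.
Proof.
rewrite dotDr dotNr ![dot (y - x) _]dotC !dotDr !dotNr (dotC y x).
by ring.
Qed.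

End dot_algebra.

(** * Time derivatives *)

Section derivatives.
Context {R : realType} {d : nat}.
Implicit Types (f g : R -> 'rV[R]_d) (m : R -> R) (t : R).

Lemma derive_coord f t k : derivable f t 1 ->
  ('D_1 f t) 0 k = 'D_1 (fun s => f s 0 k) t.
Proof. by move=> df; rewrite derive_mx// mxE. Qed.

Lemma is_derive_dot f g t : derivable f t 1 -> derivable g t 1 ->
  is_derive t 1 (fun s => dot (f s) (g s))
    (dot (g t) ('D_1 f t) + dot (f t) ('D_1 g t)).
Proof.
move=> df dg.
have -> : (fun s => dot (f s) (g s)) =
    \sum_(k < d) ((fun s => f s 0 k) * (fun s => g s 0 k)).
  by apply/funext => s; rewrite fct_sumE.
rewrite addrC -big_split; apply: is_derive_sum => k.
rewrite !derive_coord//; apply: is_deriveM; apply: derivableP.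
- by move/derivable_mxP : df; exact.
- by move/derivable_mxP : dg; exact.
Qed.

Lemma derive_scale m f t : derivable m t 1 -> derivable f t 1 ->
  'D_1 (fun s => m s *: f s) t = m t *: 'D_1 f t + 'D_1 m t *: f t.
Proof.
move=> dm df.
have dfk k : derivable (fun s => f s 0 k) t 1.
  by move/derivable_mxP : df; exact.
have E k : (fun s => (m s *: f s) 0 k) = m * (fun s => f s 0 k).
  by apply/funext => s; rewrite mxE.
rewrite derive_mx; last first.
  by apply/derivable_mxP => i k; rewrite (ord1 i) E; exact: derivableM.
apply/rowP => k; rewrite !mxE E deriveM// derive_coord//.
by congr (_ + _); exact: mulrC.
Qed.

(** Multiplying the momentum rate by the velocity counts
    [rho dm/dt |f|^2] in full, whereas the energy rate contains half of it:
    this is the excess that the volume fluxes have to compensate. *)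
Lemma is_derive_energy m f rho t : derivable m t 1 -> derivable f t 1 ->
  is_derive t 1 (fun s => m s * (2^-1 * rho * dot (f s) (f s)))
    (dot (f t) ('D_1 (fun s => (m s * rho) *: f s) t)
     - 2^-1 * rho * 'D_1 m t * dot (f t) (f t)).
Proof.
move=> dm df.
have dmr : is_derive t 1 (fun s => m s * rho) ('D_1 m t * rho).
  have -> : (fun s => m s * rho) = rho \*: m.
    by apply/funext => s; exact: mulrC.
  by rewrite mulrC; apply: is_deriveZ; exact: derivableP.
(* [dmr], [dff] and [dm'] are found below by instance resolution *)
have dff := is_derive_dot df df.
have -> : (fun s => m s * (2^-1 * rho * dot (f s) (f s))) =
    m * ((2^-1 * rho) \*: (fun s => dot (f s) (f s))) by [].
have dm' := derivableP dm.
apply: is_derive_eq.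
rewrite derive_scale//.
rewrite (@derive_val _ _ _ _ _ _ _ dmr) dotDr !dotZr.
(* scaling a real number is multiplication, which [field] does not see *)
do 2!rewrite /GRing.scale/=.
by field.
Qed.

End derivatives.

Lemma nonincreasing_derive1_le0 (R : realType) (J : set R) (f : R -> R) :
  is_interval J -> (forall t, J t -> derivable f t 1) ->
  (forall t, J t -> derive1 f t <= 0) ->
  forall s t, J s -> J t -> s <= t -> f t <= f s.
Proof.
move=> itvJ df f'0 s t Js Jt st.
have sub x : x \in `[s, t] -> J x.
  by rewrite in_itv/= => xst; exact: (itvJ s t).
have oc x : x \in `]s, t[ -> x \in `[s, t].
  by rewrite !in_itv/= => /andP[/ltW-> /ltW->].
apply: (@ler0_derive1_le_cc _ f s t) => //.
- by move=> x /oc/sub; exact: df.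
- by move=> x /oc/sub; exact: f'0.
- by apply: derivable_within_continuous => x /sub; exact: df.
- by rewrite in_itv/= lexx st.
- by rewrite in_itv/= lexx st.
Qed.

(** * Antisymmetry of face quantities *)

(** Exchanging the two sums turns the sum into its opposite; [A] has to contain
    the neighbours of its elements for the exchanged sum to have the same
    range. *)
Lemma sum_antisym_eq0 (R : numDomainType) (I : finType) (A : {set I})
    (e : rel I) (F : I -> I -> R) :
  (forall i j, i \in A -> e i j -> j \in A) -> symmetric e ->
  (forall i j, e i j -> F j i = - F i j) ->
  \sum_(i in A) \sum_(j | e i j) F i j = 0.
Proof.
move=> eA esym FN; set S := LHS.
suff : S = - S by move=> /eqP; rewrite -addr_eq0 -mulr2n mulrn_eq0 => /eqP.
rewrite {1}/S (exchange_big_dep (mem A))/=; last exact: eA.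
rewrite -sumrN; apply: eq_bigr => j jA.
rewrite -sumrN; apply: eq_big => [i|i /andP[_ eij]].
  by rewrite esym andbC; case: (boolP (e j i)) => //= /(eA _ _ jA).
by rewrite FN ?opprK // esym.
Qed.

(** Negation swaps the integrals of the positive and negative parts; if both are
    infinite, the extended integral is [-oo] for [f] and for [- f], which [fine]
    sends to [0]. *)
Lemma Rintegral_oppr d (T : measurableType d) (R : realType)
    (mu : {measure set T -> \bar R}) (D : set T) (f : T -> R) :
  \int[mu]_(x in D) (- f x) = - \int[mu]_(x in D) f x.
Proof.
rewrite /Rintegral.
have -> : (fun x => (- f x)%:E) = (fun x => - (f x)%:E)%E by [].
rewrite integralE [in RHS]integralE funeposN funenegN.
case: integral => [a| |]; case: integral => [b| |] //=;
  by rewrite ?oppr0 ?opprB.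
Qed.

Section faces.
Context {R : realType} {d : nat} {I : finType} {J : set R}.
Variable M : moving_mesh d I J.

Lemma faceC i j t : face M i j t = face M j i t.
Proof. by rewrite /face setIC. Qed.

Lemma areaC i j t : area M i j t = area M j i t.
Proof. by rewrite /area faceC. Qed.

Lemma area_ge0 i j t : 0 <= area M i j t.
Proof. by apply: fine_ge0; exact: measure_ge0. Qed.

Lemma adj_sym t : J t -> symmetric (adj M).
Proof.
move=> Jt i j; apply/idP/idP => /(adjP M _ _ Jt)[ij aij]; apply/(adjP M _ _ Jt).
  by rewrite eq_sym faceC.
by rewrite eq_sym faceC.
Qed.

(** [w] is the averaged cell velocity or the mesh velocity: both are the same
    vector field whichever side the face is seen from. *)
Lemma Rintegral_normal_antisym (w : surface_space R d -> 'rV[R]_d) i j t :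
  J t -> adj M i j ->
  \int[surface R d]_(x in face M j i t) dot (w x) (normal M j i t x) =
  - \int[surface R d]_(x in face M i j t) dot (w x) (normal M i j t x).
Proof.
move=> Jt aij; rewrite faceC -Rintegral_oppr.
apply: eq_Rintegral => x; rewrite inE => fx.
by rewrite (normal_sym Jt aij fx) dotNr.
Qed.

Lemma face_velocity_antisym u i j t : J t -> adj M i j ->
  face_velocity M u j i t = - face_velocity M u i j t.
Proof.
move=> Jt aij; rewrite /face_velocity areaC addrC.
by rewrite (Rintegral_normal_antisym (fun=> _) Jt aij) mulrN.
Qed.

Lemma face_mesh_velocity_antisym i j t : J t -> adj M i j ->
  face_mesh_velocity M j i t = - face_mesh_velocity M i j t.
Proof.
move=> Jt aij; rewrite /face_mesh_velocity areaC.
by rewrite (Rintegral_normal_antisym (velocity M t) Jt aij) mulrN.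
Qed.

End faces.

(** * Energy balance of a cell *)

(** The algebra behind the local balance: [x] is the velocity of the cell and
    [y j] that of its neighbours, [dq] the momentum rate, [dm] the volume rate,
    [a j] the relative volume fluxes and [b j] the dissipation coefficients.
    Once [x . dq] is eliminated, both sides agree face by face. *)
Lemma ducros_balance (R : realType) (d : nat) (I : finType) (P : pred I)
    (rho dm : R) (a b : I -> R) (x dq : 'rV[R]_d) (y : I -> 'rV[R]_d) :
  dm = - \sum_(j | P j) a j ->
  dq + \sum_(j | P j) (a j * (2^-1 * rho)) *: (x + y j)
    = \sum_(j | P j) (b j * rho) *: (y j - x) ->
  dot x dq - 2^-1 * rho * dm * dot x x
  + \sum_(j | P j) a j * (2^-1 * rho) * dot x (y j)
  - \sum_(j | P j) b j * (2^-1 * rho) * (dot (y j) (y j) - dot x x)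
  = - \sum_(j | P j) b j * (2^-1 * rho) * dot (y j - x) (y j - x).
Proof.
move=> -> /(congr1 (dot x)); rewrite dotDr !dot_sumr => /eqP.
rewrite -subr_eq0 => /eqP mom.
(* subtract the momentum equation multiplied by [x], so that the remaining terms
   are sums over the same neighbours *)
apply/eqP; rewrite -subr_eq0 -[X in _ == X]mom opprK; apply/eqP.
rewrite -!addrA; congr (_ + _).
have -> : 2^-1 * rho * (- \sum_(j | P j) a j) * dot x x =
    - \sum_(j | P j) a j * (2^-1 * rho * dot x x).
  by rewrite -mulr_suml; ring.
(* [P] is given so that the sums inside [dot] are left alone *)
rewrite opprK -!(@sumrN _ _ _ P) -!big_split/=.
apply: eq_bigr => j _; rewrite dot_sub_sqr !dotZr !dotDr dotNr.
by field.
Qed.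

(** * Energy dissipation *)

Theorem mainTheorem2 (R : realType) (d : nat) (hd : d = 2%N \/ d = 3%N)
    (J : set R) (J_open : open J) (J_interval : is_interval J)
    (I : finType) (M : moving_mesh d I J)
    (rho : R) (rho_gt0 : 0 < rho)
    (u : I -> R -> 'rV[R]_d) (smax : I -> I -> R -> R)
    (smax_ge0 : forall i j t, J t -> adj M i j -> 0 <= smax i j t)
    (smax_sym : forall i j t, J t -> adj M i j -> smax i j t = smax j i t)
    (u_derivable : forall i t, J t -> i \in mesh M -> derivable (u i) t 1)
    (volume_derivable :
      forall i t, J t -> i \in mesh M -> derivable (volume M i) t 1)
    (divergence_free : forall i t, J t -> i \in mesh M ->
      \sum_(j | adj M i j) area M i j t * face_velocity M u i j t = 0)
    (geometric_conservation : forall i t, J t -> i \in mesh M ->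
      derive1 (volume M i) t
      - \sum_(j | adj M i j) area M i j t * face_mesh_velocity M i j t = 0)
    (scheme : forall i t, J t -> i \in mesh M ->
      derive1 (fun s => (volume M i s * rho) *: u i s) t
      + \sum_(j | adj M i j)
          (area M i j t * (face_velocity M u i j t - face_mesh_velocity M i j t)
           * (2^-1 * rho)) *: (u i t + u j t)
      = \sum_(j | adj M i j)
          (area M i j t * (2^-1 * smax i j t) * rho) *: (u j t - u i t)) :
  (forall i t, J t -> i \in mesh M ->
    derive1 (kinetic_energy M rho u i) t
    + \sum_(j | adj M i j)
        area M i j t * (face_velocity M u i j t - face_mesh_velocity M i j t)
        * (2^-1 * rho) * dot (u i t) (u j t)
    - \sum_(j | adj M i j)
        area M i j t * (2^-1 * smax i j t) * (2^-1 * rho)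
        * (dot (u j t) (u j t) - dot (u i t) (u i t))
    = - \sum_(j | adj M i j)
          area M i j t * (2^-1 * smax i j t) * (2^-1 * rho)
          * dot (u j t - u i t) (u j t - u i t)
    /\ - \sum_(j | adj M i j)
          area M i j t * (2^-1 * smax i j t) * (2^-1 * rho)
          * dot (u j t - u i t) (u j t - u i t) <= 0)
  /\
  ((* no fluxes through the boundary *)
   (forall i j, i \in mesh M -> adj M i j -> j \in mesh M) ->
   (forall t, J t ->
      \sum_(i in mesh M) derive1 (kinetic_energy M rho u i) t
      = - \sum_(i in mesh M) \sum_(j | adj M i j)
            area M i j t * (2^-1 * smax i j t) * (2^-1 * rho)
            * dot (u j t - u i t) (u j t - u i t)
      /\ - \sum_(i in mesh M) \sum_(j | adj M i j)
            area M i j t * (2^-1 * smax i j t) * (2^-1 * rho)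
            * dot (u j t - u i t) (u j t - u i t) <= 0)
   /\
   (forall s t, J s -> J t -> s <= t ->
      \sum_(i in mesh M) kinetic_energy M rho u i t
      <= \sum_(i in mesh M) kinetic_energy M rho u i s)).
Proof.
pose D i j t := area M i j t * (2^-1 * smax i j t) * (2^-1 * rho).
have D_ge0 i j t : J t -> adj M i j -> 0 <= D i j t.
  move=> Jt aij; rewrite /D !mulr_ge0 ?area_ge0 ?invr_ge0 ?smax_ge0//.
  exact: ltW.
have dissipation_ge0 i t : J t ->
    0 <= \sum_(j | adj M i j) D i j t * dot (u j t - u i t) (u j t - u i t).
  by move=> Jt; apply: sumr_ge0 => j aij; rewrite mulr_ge0 ?D_ge0 ?dot_ge0.
have energy_derive i t (Jt : J t) (iM : i \in mesh M) :=
  is_derive_energy rho (volume_derivable i t Jt iM) (u_derivable i t Jt iM).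
have balance i t : J t -> i \in mesh M ->
    derive1 (kinetic_energy M rho u i) t
    + \sum_(j | adj M i j)
        area M i j t * (face_velocity M u i j t - face_mesh_velocity M i j t)
        * (2^-1 * rho) * dot (u i t) (u j t)
    - \sum_(j | adj M i j) D i j t * (dot (u j t) (u j t) - dot (u i t) (u i t))
    = - \sum_(j | adj M i j) D i j t * dot (u j t - u i t) (u j t - u i t).
  move=> Jt iM; rewrite derive1E /kinetic_energy.
  rewrite (@derive_val _ _ _ _ _ _ _ (energy_derive i t Jt iM)).
  have := scheme i t Jt iM; rewrite derive1E => /ducros_balance; apply.
  (* the volume fluxes relative to the moving faces add up to - d|C_i|/dt *)
  have /eqP := geometric_conservation i t Jt iM.
  rewrite subr_eq0 derive1E => /eqP ->.
  under [in RHS]eq_bigr do rewrite mulrBr.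
  by rewrite sumrB divergence_free// sub0r opprK.
split.
  move=> i t Jt iM; split; first exact: balance.
  by rewrite oppr_le0 dissipation_ge0.
move=> closed_mesh.
have total t : J t ->
    \sum_(i in mesh M) derive1 (kinetic_energy M rho u i) t
    = - \sum_(i in mesh M) \sum_(j | adj M i j)
          D i j t * dot (u j t - u i t) (u j t - u i t).
  move=> Jt.
  have flux0 : \sum_(i in mesh M) \sum_(j | adj M i j)
      area M i j t * (face_velocity M u i j t - face_mesh_velocity M i j t)
      * (2^-1 * rho) * dot (u i t) (u j t) = 0.
    apply: sum_antisym_eq0 => [//||i j aij]; first exact: adj_sym Jt.
    rewrite areaC (face_velocity_antisym _ Jt aij).
    rewrite (face_mesh_velocity_antisym Jt aij) dotC.
    by ring.
  have diffusion0 : \sum_(i in mesh M) \sum_(j | adj M i j)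
      D i j t * (dot (u j t) (u j t) - dot (u i t) (u i t)) = 0.
    apply: sum_antisym_eq0 => [//||i j aij]; first exact: adj_sym Jt.
    rewrite /D areaC (smax_sym i j)//.
    by ring.
  rewrite -sumrN -(eq_bigr _ (fun i => balance i t Jt)).
  by rewrite sumrB big_split/= flux0 diffusion0 addr0 subr0.
have total_le0 t : J t ->
    - \sum_(i in mesh M) \sum_(j | adj M i j)
        D i j t * dot (u j t - u i t) (u j t - u i t) <= 0.
  by move=> Jt; rewrite oppr_le0 sumr_ge0// => i _; exact: dissipation_ge0.
split; first by move=> t Jt; split; [exact: total|exact: total_le0].
pose E t := \sum_(i in mesh M) kinetic_energy M rho u i t.
have E_derive t : J t ->
    is_derive t 1 E (\sum_(i in mesh M) derive1 (kinetic_energy M rho u i) t).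
  move=> Jt.
  have -> : E = \sum_(i in mesh M) kinetic_energy M rho u i.
    by apply/funext => s; rewrite fct_sumE.
  elim/big_ind2 : _ => [|f f' g g' df dg|i iM]; first exact: is_derive_cst.
  - exact: is_deriveD.
  - by rewrite derive1E; apply: derivableP; case: (energy_derive i t Jt iM).
apply: (@nonincreasing_derive1_le0 _ J E) => // t Jt.
  by case: (E_derive t Jt).
by rewrite derive1E (@derive_val _ _ _ _ _ _ _ (E_derive t Jt)) total ?total_le0.
Qed.
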